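(* Let $p$ be a prime greater than $2$, let $B(n,p)$ be the free Burnside group of rank $n$ and exponent $p$, let $t$ be the automorphism of order $2$ of $B(n,p)$ that inverts the free generators, let $G=B(n,p).\langle t\rangle$ (the extension of $B(n,p)$ by $\langle t\rangle$), and let $T=t^G$ be the conjugacy class of $t$ in $G$. Let $\mathbb{F}$ be a field of good characteristic relative to $(p,\eta)$, where $\eta\in\mathbb{F}$. Then $Miy(A_{\mathbb{F}}(G,T,\eta),T)\simeq G/Z(G)$, where $Z(G)$ is the center of $G$, and $G$ is finite if and only if $A_{\mathbb{F}}(G,T,\eta)$ is finite-dimensional.
   Context: Burnside group: $B(n,p)$ is the quotient of the free group $F_n$ of rank $n$ by the normal closure of $\{g^p\mid g\in F_n\}$. Here $G$ is generated by the involutions in $T$ and the product of any two distinct elements of $T$ has order $p$. Algebra. Fields have characteristic not $2$; algebras are not assumed associative or commutative. Write $a^b=b^{-1}ab$, and let $I(a,b)$ be the set of all involutions of the dihedral group $\langle a,b\rangle$. $A=A_{\mathbb{F}}(G,T,\eta)$ (for $\eta\in\mathbb{F}\setminus\{0,1\}$) is the $\mathbb{F}$-algebra with basis $T$ and bilinear product $a*a=a$, and $a*b=b^a+\eta\sum_{x\in I(a,b)\setminus\{b^a\}}x$ for $a\ne b$ in $T$. The field $\mathbb{F}$ has good characteristic relative to $(p,\eta)$ if $1,\ \eta(p-2)+1,\ \eta-1,\ 1-\eta$ are distinct in $\mathbb{F}$. Miyamoto group. For $a\in T$ define $A_a^{\pm}$ as follows. For $b\in T\setminus\{a\}$ enumerate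 $I(a,b)$ as $a_1=a$, $a_2=b$, $a_{i+1}=a_{i-1}^{a_i}$ ($i\le p-1$), and put $z=\frac{1}{p-2}a+\sum_{j=1}^p a_j$; $y_i=a_{i+1}-a_{(p+1)/2}-a_{(p+3)/2}+a_{p+1-i}$ for $1\le i\le\frac{p-3}{2}$; $x_i=a_{p+1-i}-a_{i+1}$ for $1\le i\le\frac{p-1}{2}$. Then $A_a^+$ is the linear span of $a$ and all the $z,y_i$ for all $b\in T\setminus\{a\}$, and $A_a^-$ is the linear span of all the $x_i$ for all $b\in T\setminus\{a\}$; one has $A=A_a^+\oplus A_a^-$. The Miyamoto involution $\tau_a$ is the linear map equal to $+1$ on $A_a^+$ and $-1$ on $A_a^-$, and $Miy(A,T)=\langle\tau_a\mid a\in T\rangle$. *)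

(* Defs.v *)
From HB Require Import structures.
From mathcomp Require Import all_boot all_algebra.
From mathcomp Require Import boolp classical_sets functions cardinality fsbigop.
From mathcomp Require Import finmap monalg.

Set Implicit Arguments.
Unset Strict Implicit.
Unset Printing Implicit Defensive.

Import GRing.Theory.

Local Open Scope classical_set_scope.
Local Open Scope quotient_scope.

Section Subgroups.
Local Open Scope group_scope.
Variable G : groupType.
Implicit Types (S H : set G) (x y : G).

Definition subgroup_set H := H 1 /\ forall x y, H x -> H y -> H (x / y).

Definition normal_subgroup_set H :=
  subgroup_set H /\ forall x y, H x -> H (x ^ y).

Definition generated S : set G := smallest subgroup_set S.

Definition normal_closure S : set G := smallest normal_subgroup_set S.

Definition center : set G := [set z | forall x, z * x = x * z].

Definition conj_class x : set G := [set x ^ y | y in [set: G]].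

Lemma generated_subgroup S : subgroup_set (generated S).
Proof.
split=> [H [[H1 _] _] //|x y Sx Sy H HS].
by apply: HS.1.2; [apply: Sx|apply: Sy].
Qed.

Lemma normal_closure_normal S : normal_subgroup_set (normal_closure S).
Proof.
split; first split=> [H [[[H1 _] _] _] //|x y Sx Sy H HS].
  by apply: HS.1.1.2; [apply: Sx|apply: Sy].
by move=> x y Sx H HS; apply: HS.1.2; apply: Sx.
Qed.

Lemma center_normal : normal_subgroup_set center.
Proof.
have cJ z y : center z -> z ^ y = z.
  by move=> cz; rewrite conjgE cz mulgA mulVg mul1g.
split=> [|x y /[dup] cx /(@cJ _ y)->//]; split=> [x|x y cx cy z].
  by rewrite mulg1 mul1g.
have cVy : y^-1 * z = z * y^-1.
  by apply: (mulgI y); rewrite mulVKg mulgA cy mulgK.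
by rewrite -mulgA cVy mulgA (cx z) mulgA.
Qed.

End Subgroups.

Record normal_subgroup (G : groupType) := NormalSubgroup {
  nsubgroup_set : set G;
  nsubgroupP : normal_subgroup_set nsubgroup_set }.

Definition center_subgroup (G : groupType) : normal_subgroup G :=
  NormalSubgroup (@center_normal G).

Section Quotient.
Local Open Scope group_scope.
Variables (G : groupType) (M : normal_subgroup G).
Implicit Types x y z : G.
Local Notation N := (nsubgroup_set M).

Fact nsub1 : N 1. Proof. exact: (nsubgroupP M).1.1. Qed.
Fact nsubF x y : N x -> N y -> N (x / y).
Proof. exact: (nsubgroupP M).1.2. Qed.
Fact nsubV x : N x -> N x^-1.
Proof. by move=> Nx; rewrite -(mul1g x^-1); apply: nsubF => //; apply: nsub1. Qed.
Fact nsubM x y : N x -> N y -> N (x * y).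
Proof. by move=> Nx Ny; rewrite -(invgK y); apply: nsubF => //; apply: nsubV. Qed.
Fact nsubJ x y : N x -> N (x ^ y). Proof. exact: (nsubgroupP M).2. Qed.

Definition coset_rel : rel G := fun x y => `[< N (x^-1 * y) >].

Lemma coset_rel_refl : reflexive coset_rel.
Proof. by move=> x; apply/asboolP; rewrite mulVg; apply: nsub1. Qed.

Lemma coset_rel_sym : symmetric coset_rel.
Proof.
suff imp x y : coset_rel x y -> coset_rel y x by move=> x y; apply/idP/idP => /imp.
by move=> /asboolP/nsubV; rewrite invgM invgK => ?; apply/asboolP.
Qed.

Lemma coset_rel_trans : transitive coset_rel.
Proof.
move=> y x z /asboolP Nxy /asboolP Nyz; apply/asboolP.
by have := nsubM Nxy Nyz; rewrite mulgA mulgK.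
Qed.

Canonical coset_equiv := EquivRel coset_rel coset_rel_refl coset_rel_sym coset_rel_trans.

Definition quotient_group := {eq_quot coset_equiv}.
HB.instance Definition _ := Choice.on quotient_group.

Definition quotient_map (x : G) : quotient_group := \pi_{eq_quot coset_equiv} x.

Lemma quotient_mapP x y : quotient_map x = quotient_map y <-> N (x^-1 * y).
Proof.
by split=> [/eqmodP/asboolP|Nxy]; last by apply/eqmodP/asboolP.
Qed.

Definition quotient_repr (a : quotient_group) : G :=
  repr (a : {eq_quot coset_equiv}).

Lemma quotient_reprK : cancel quotient_repr quotient_map.
Proof. exact: reprK. Qed.

Definition quotient_mul (a b : quotient_group) :=
  quotient_map (quotient_repr a * quotient_repr b).
Definition quotient_inv (a : quotient_group) := quotient_map (quotient_repr a)^-1.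

Fact quotient_mulE x y :
  quotient_mul (quotient_map x) (quotient_map y) = quotient_map (x * y).
Proof.
rewrite /quotient_mul; set x' := quotient_repr _; set y' := quotient_repr _.
have Nx : N (x'^-1 * x) by apply/quotient_mapP; rewrite quotient_reprK.
have Ny : N (y'^-1 * y) by apply/quotient_mapP; rewrite quotient_reprK.
apply/quotient_mapP.
have -> : (x' * y')^-1 * (x * y) = (x'^-1 * x) ^ y' * (y'^-1 * y).
  by rewrite conjgE invgM !mulgA mulgK.
by apply: nsubM => //; apply: nsubJ.
Qed.

Fact quotient_invE x : quotient_inv (quotient_map x) = quotient_map x^-1.
Proof.
rewrite /quotient_inv; set x' := quotient_repr _.
have Nx : N (x^-1 * x') by apply/quotient_mapP; rewrite quotient_reprK.
apply/quotient_mapP.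
have -> : (x'^-1)^-1 * x^-1 = (x^-1 * x') ^ x^-1.
  by rewrite conjgE !invgK !mulgA mulgV mul1g.
exact: nsubJ.
Qed.

Fact quotient_mulA : associative quotient_mul.
Proof.
move=> a b c; rewrite -[a]quotient_reprK -[b]quotient_reprK -[c]quotient_reprK.
by rewrite !quotient_mulE mulgA.
Qed.
Fact quotient_mul1 : left_id (quotient_map 1) quotient_mul.
Proof. by move=> a; rewrite -[a]quotient_reprK quotient_mulE mul1g. Qed.
Fact quotient_mulr1 : right_id (quotient_map 1) quotient_mul.
Proof. by move=> a; rewrite -[a]quotient_reprK quotient_mulE mulg1. Qed.
Fact quotient_mulV : left_inverse (quotient_map 1) quotient_inv quotient_mul.
Proof. by move=> a; rewrite -[a]quotient_reprK quotient_invE quotient_mulE mulVg. Qed.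
Fact quotient_mulrV : right_inverse (quotient_map 1) quotient_inv quotient_mul.
Proof. by move=> a; rewrite -[a]quotient_reprK quotient_invE quotient_mulE mulgV. Qed.

HB.instance Definition _ := isGroup.Build quotient_group
  quotient_mulA quotient_mul1 quotient_mulr1 quotient_mulV quotient_mulrV.

Lemma quotient_mapM : {morph quotient_map : x y / x * y}.
Proof. by move=> x y; rewrite -quotient_mulE. Qed.

Lemma quotient_map1 : quotient_map 1 = 1.
Proof. by []. Qed.

Lemma quotient_mapV : {morph quotient_map : x / x^-1}.
Proof. by move=> x; rewrite -quotient_invE. Qed.

End Quotient.

(* The free group on [X], as words in the letters [(x, false)] = x and
   [(x, true)] = x^-1 modulo insertion and deletion of cancelling pairs. *)
Section FreeGroup.
Local Open Scope group_scope.
Variable X : choiceType.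
Implicit Types u v w : seq (X * bool).

Inductive word_eq : seq (X * bool) -> seq (X * bool) -> Prop :=
| WordCancel u v x b : word_eq (u ++ [:: (x, b); (x, ~~ b)] ++ v) (u ++ v)
| WordRefl u : word_eq u u
| WordSym u v : word_eq u v -> word_eq v u
| WordTrans v u w : word_eq u v -> word_eq v w -> word_eq u w.

Definition word_rel : rel (seq (X * bool)) := fun u v => `[< word_eq u v >].

Lemma word_rel_refl : reflexive word_rel.
Proof. by move=> u; apply/asboolP/WordRefl. Qed.

Lemma word_rel_sym : symmetric word_rel.
Proof. by move=> u v; apply/idP/idP => /asboolP/WordSym ?; apply/asboolP. Qed.

Lemma word_rel_trans : transitive word_rel.
Proof. by move=> v u w /asboolP uv /asboolP vw; apply/asboolP/(WordTrans uv). Qed.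

Canonical word_equiv := EquivRel word_rel word_rel_refl word_rel_sym word_rel_trans.

Definition free_group := {eq_quot word_equiv}.
HB.instance Definition _ := Choice.on free_group.

Definition word_class u : free_group := \pi_{eq_quot word_equiv} u.
Definition word_of (g : free_group) : seq (X * bool) :=
  repr (g : {eq_quot word_equiv}).

Lemma word_ofK : cancel word_of word_class.
Proof. exact: reprK. Qed.

Lemma word_classP u v : word_class u = word_class v <-> word_eq u v.
Proof. by split=> [/eqmodP/asboolP|uv]; last by apply/eqmodP/asboolP. Qed.

Lemma word_eq_catl u v w : word_eq v w -> word_eq (u ++ v) (u ++ w).
Proof.
elim=> [v1 v2 x b|v1|v1 v2 _|v2 v1 v3 _ + _]; last exact: WordTrans.
- by rewrite catA (catA u v1 v2); apply: WordCancel.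
- exact: WordRefl.
- exact: WordSym.
Qed.

Lemma word_eq_catr u v w : word_eq v w -> word_eq (v ++ u) (w ++ u).
Proof.
elim=> [v1 v2 x b|v1|v1 v2 _|v2 v1 v3 _ + _]; last exact: WordTrans.
- by rewrite -!catA; apply: WordCancel.
- exact: WordRefl.
- exact: WordSym.
Qed.

Definition word_inv u := rev [seq (a.1, ~~ a.2) | a <- u].

Lemma word_inv_eq u v : word_eq u v -> word_eq (word_inv u) (word_inv v).
Proof.
elim=> [v1 v2 x b|v1|v1 v2 _|v2 v1 v3 _ + _]; last exact: WordTrans.
- rewrite /word_inv !map_cat !rev_cat -catA.
  by rewrite /= negbK; apply: WordCancel.
- exact: WordRefl.
- exact: WordSym.
Qed.

Lemma word_invK : involutive word_inv.
Proof.
move=> u; rewrite /word_inv map_rev revK -map_comp map_id_in // => -[x b] _.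
by rewrite /= negbK.
Qed.

Lemma word_mulV u : word_eq (u ++ word_inv u) [::].
Proof.
elim: u => [|[x b] u IHu]; first exact: WordRefl.
rewrite /word_inv map_cons rev_cons -cats1 -/(word_inv u) -cat1s -catA.
apply: WordTrans (WordCancel [::] [::] x b).
by apply: (@word_eq_catl [:: (x, b)]); rewrite catA; apply: (@word_eq_catr _ _ [::]).
Qed.

Definition free_mul (g h : free_group) := word_class (word_of g ++ word_of h).
Definition free_inv (g : free_group) := word_class (word_inv (word_of g)).

Fact free_mulE u v : free_mul (word_class u) (word_class v) = word_class (u ++ v).
Proof.
apply/word_classP; apply: (@WordTrans (u ++ word_of (word_class v))).
  by apply: word_eq_catr; apply/word_classP; rewrite word_ofK.
by apply: word_eq_catl; apply/word_classP; rewrite word_ofK.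
Qed.

Fact free_invE u : free_inv (word_class u) = word_class (word_inv u).
Proof. by apply/word_classP/word_inv_eq/word_classP; rewrite word_ofK. Qed.

Fact free_mulA : associative free_mul.
Proof.
move=> g h k; rewrite -[g]word_ofK -[h]word_ofK -[k]word_ofK.
by rewrite !free_mulE catA.
Qed.
Fact free_mul1 : left_id (word_class [::]) free_mul.
Proof. by move=> g; rewrite -[g]word_ofK free_mulE. Qed.
Fact free_mulr1 : right_id (word_class [::]) free_mul.
Proof. by move=> g; rewrite -[g]word_ofK free_mulE cats0. Qed.
Fact free_mulrV : right_inverse (word_class [::]) free_inv free_mul.
Proof.
by move=> g; rewrite -[g]word_ofK free_invE free_mulE; apply/word_classP/word_mulV.
Qed.
Fact free_mulV : left_inverse (word_class [::]) free_inv free_mul.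
Proof.
move=> g; rewrite -[g]word_ofK free_invE free_mulE; apply/word_classP.
by rewrite -{2}[word_of g]word_invK; apply: word_mulV.
Qed.

HB.instance Definition _ := isGroup.Build free_group
  free_mulA free_mul1 free_mulr1 free_mulV free_mulrV.

Definition free_gen (x : X) : free_group := word_class [:: (x, false)].

Section Lift.
Variables (H : groupType) (f : X -> H).

Definition word_eval u : H := \prod_(a <- u) (if a.2 then (f a.1)^-1 else f a.1).

Lemma word_eval_eq u v : word_eq u v -> word_eval u = word_eval v.
Proof.
rewrite /word_eval; elim=> [v1 v2 x b|v1|v1 v2 _ ->|v2 v1 v3 _ -> _ ->] //.
rewrite !big_cat /= !big_cons big_nil /=; congr (_ * _).
by case: b; rewrite /= mulg1 ?mulgV ?mulVg mul1g.
Qed.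

Definition free_lift (g : free_group) : H := word_eval (word_of g).

Lemma free_lift_class u : free_lift (word_class u) = word_eval u.
Proof. by apply/word_eval_eq/word_classP; rewrite word_ofK. Qed.

Lemma free_lift_gen x : free_lift (free_gen x) = f x.
Proof. by rewrite free_lift_class /word_eval big_seq1. Qed.

Lemma free_liftM : {morph free_lift : g h / g * h}.
Proof. by move=> g h; rewrite free_lift_class /word_eval big_cat. Qed.

Lemma free_lift1 : free_lift 1 = 1.
Proof. by apply: (mulgI (free_lift 1)); rewrite -free_liftM !mulg1. Qed.

Lemma free_liftV : {morph free_lift : g / g^-1}.
Proof.
by move=> g; apply: (mulgI (free_lift g)); rewrite -free_liftM !mulgV free_lift1.
Qed.

Lemma free_liftX m : {morph free_lift : g / g ^+ m}.
Proof.
move=> g; elim: m => [|m IHm]; first by rewrite !expg0 free_lift1.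
by rewrite !expgS free_liftM IHm.
Qed.

End Lift.

Lemma free_group_ind (P : free_group -> Prop) :
  P 1 -> (forall x g, P g -> P (free_gen x * g)) ->
  (forall x g, P g -> P ((free_gen x)^-1 * g)) -> forall g, P g.
Proof.
move=> P1 PM PV g; rewrite -[g]word_ofK.
elim: (word_of g) => [//|[x b] u IHu].
rewrite -cat1s -free_mulE.
case: b; last exact: PM.
by rewrite -[word_class _](free_invE [:: (x, false)]); apply: PV.
Qed.

End FreeGroup.

Section Burnside.
Local Open Scope group_scope.
Variables n p : nat.

Definition burnside_relators : normal_subgroup (free_group 'I_n) :=
  NormalSubgroup (normal_closure_normal [set g ^+ p | g in [set: free_group 'I_n]]).

Definition burnside : groupType := quotient_group burnside_relators.

Definition burnside_gen (i : 'I_n) : burnside :=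
  quotient_map burnside_relators (free_gen i).

Lemma burnside_exp (a : burnside) : a ^+ p = 1.
Proof.
rewrite -[a](@quotient_reprK _ burnside_relators); set g := quotient_repr _.
have X m : quotient_map burnside_relators g ^+ m
           = quotient_map burnside_relators (g ^+ m).
  elim: m => [//|m IHm]; by rewrite !expgS IHm quotient_mapM.
rewrite X; apply/esym/quotient_mapP; rewrite invg1 mul1g.
by apply: sub_gen_smallest; exists g.
Qed.

Section Lift.
Variables (H : groupType) (f : 'I_n -> H).
Hypothesis Hp : forall h : H, h ^+ p = 1.

Definition burnside_lift (a : burnside) : H :=
  free_lift f (@quotient_repr _ burnside_relators a).

Lemma burnside_lift_map g :
  burnside_lift (quotient_map burnside_relators g) = free_lift f g.
Proof.
have kerN : normal_subgroup_set [set g | free_lift f g = 1].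
  split=> [|h k /= h1]; last first.
    by rewrite conjgE !free_liftM free_liftV h1 mul1g mulVg.
  split=> [|h k /= h1 k1] /=; first exact: free_lift1.
  by rewrite free_liftM free_liftV h1 k1 mulgV.
have kerP h : nsubgroup_set burnside_relators h -> free_lift f h = 1.
  move=> /(_ [set g | free_lift f g = 1]); apply; split=> // _ [k _ <-] /=.
  by rewrite free_liftX Hp.
rewrite /burnside_lift; set h := quotient_repr _.
have /kerP : nsubgroup_set burnside_relators (h^-1 * g).
  by apply/quotient_mapP; rewrite quotient_reprK.
rewrite free_liftM free_liftV => /(congr1 (fun y => free_lift f h * y)).
by rewrite mulVKg mulg1.
Qed.

Lemma burnside_liftM : {morph burnside_lift : a b / a * b}.
Proof.
move=> a b; rewrite -[a](@quotient_reprK _ burnside_relators).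
rewrite -[b](@quotient_reprK _ burnside_relators) -quotient_mapM.
by rewrite !burnside_lift_map free_liftM.
Qed.

Lemma burnside_lift_gen i : burnside_lift (burnside_gen i) = f i.
Proof. by rewrite burnside_lift_map free_lift_gen. Qed.

End Lift.

Lemma burnside_ind (P : burnside -> Prop) :
  P 1 -> (forall i a, P a -> P (burnside_gen i * a)) ->
  (forall i a, P a -> P ((burnside_gen i)^-1 * a)) -> forall a, P a.
Proof.
move=> P1 PM PV a; rewrite -[a](@quotient_reprK _ burnside_relators).
elim/free_group_ind: (quotient_repr _) => [//|i g Pg|i g Pg].
  by rewrite quotient_mapM; apply: PM.
by rewrite quotient_mapM quotient_mapV; apply: PV.
Qed.

Definition burnside_inverting : burnside -> burnside :=
  burnside_lift (fun i => (burnside_gen i)^-1).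

Lemma burnside_inverting_gen i :
  burnside_inverting (burnside_gen i) = (burnside_gen i)^-1.
Proof. exact/burnside_lift_gen/burnside_exp. Qed.

Lemma burnside_invertingM : {morph burnside_inverting : a b / a * b}.
Proof. exact/burnside_liftM/burnside_exp. Qed.

Lemma burnside_inverting1 : burnside_inverting 1 = 1.
Proof.
by apply: (mulgI (burnside_inverting 1)); rewrite -burnside_invertingM !mulg1.
Qed.

Lemma burnside_invertingV : {morph burnside_inverting : a / a^-1}.
Proof.
move=> a; apply: (mulgI (burnside_inverting a)).
by rewrite -burnside_invertingM !mulgV burnside_inverting1.
Qed.

Lemma burnside_invertingK : involutive burnside_inverting.
Proof.
elim/burnside_ind => [|i a IHa|i a IHa]; first by rewrite !burnside_inverting1.
  rewrite !burnside_invertingM burnside_inverting_gen burnside_invertingV.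
  by rewrite burnside_inverting_gen invgK IHa.
rewrite !burnside_invertingM !burnside_invertingV burnside_inverting_gen.
by rewrite burnside_invertingV invgK burnside_inverting_gen IHa.
Qed.

End Burnside.

Section Order2.
Local Open Scope group_scope.

Lemma burnside_inverting_order2 (n p : nat) : (0 < n)%N -> (2 < p)%N ->
  exists a : burnside n p, burnside_inverting a <> a.
Proof.
case: n p => [//|n] [//|p] _ p_gt2; exists (burnside_gen _ ord0).
rewrite burnside_inverting_gen => aV.
have aa : burnside_gen p.+1 (@ord0 n) * burnside_gen p.+1 (@ord0 n) = 1.
  by rewrite -{1}aV mulVg.
have Hp (h : 'I_p.+1) : h ^+ p.+1 = 1.
  by rewrite Zp_expg; apply: val_inj; rewrite /= modnMl.
have := congr1 (burnside_lift (fun=> Zp1 : 'I_p.+1)) aa.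
rewrite burnside_liftM // burnside_lift_gen // => /(congr1 val).
have -> : burnside_lift (fun=> Zp1 : 'I_p.+1) (1 : burnside n.+1 p.+1) = 1.
  set f := burnside_lift _; apply: (mulgI (f 1)).
  by rewrite -burnside_liftM // !mulg1.
rewrite /= !(@modn_small 1) ?(ltn_trans _ p_gt2) //.
by rewrite modn_small.
Qed.

End Order2.

(* [(a, e)] stands for a * t ^ e, where t * a * t^-1 is the image of [a] under
   [burnside_inverting]; for 0 < n and p > 2 this automorphism has order exactly
   2 ([burnside_inverting_order2]), so that <t> is faithfully represented by [bool]. *)
Definition burnside_ext (n p : nat) : Type := (burnside n p * bool)%type.
HB.instance Definition _ n p := Choice.on (burnside_ext n p).

Section BurnsideExt.
Local Open Scope group_scope.
Variables n p : nat.
Local Notation tau := (@burnside_inverting n p).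
Implicit Types x y z : burnside_ext n p.

Definition ext_act (e : bool) (a : burnside n p) := if e then tau a else a.

Definition ext_mul x y : burnside_ext n p := (x.1 * ext_act x.2 y.1, x.2 (+) y.2).
Definition ext_inv x : burnside_ext n p := (ext_act x.2 x.1^-1, x.2).

Fact ext_mulA : associative ext_mul.
Proof.
move=> [a e] [b f] [c h]; rewrite /ext_mul /= addbA; congr (_, _).
by case: e; case: f; rewrite /= ?burnside_invertingM ?burnside_invertingK mulgA.
Qed.
Fact ext_mul1 : left_id (1, false) ext_mul.
Proof. by move=> [a e]; rewrite /ext_mul /= mul1g. Qed.
Fact ext_mulr1 : right_id (1, false) ext_mul.
Proof.
by move=> [a e]; rewrite /ext_mul /= addbF /ext_act burnside_inverting1 if_same mulg1.
Qed.
Fact ext_mulV : left_inverse (1, false) ext_inv ext_mul.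
Proof.
move=> [a e]; rewrite /ext_mul /= addbb /ext_act.
by case: e; rewrite -?burnside_invertingM mulVg ?burnside_inverting1.
Qed.
Fact ext_mulrV : right_inverse (1, false) ext_inv ext_mul.
Proof.
move=> [a e]; rewrite /ext_mul /= addbb /ext_act.
by case: e; rewrite ?burnside_invertingK mulgV.
Qed.

HB.instance Definition _ := isGroup.Build (burnside_ext n p)
  ext_mulA ext_mul1 ext_mulr1 ext_mulV ext_mulrV.

Definition ext_t : burnside_ext n p := (1, true).

Definition ext_T : set (burnside_ext n p) := conj_class ext_t.

Lemma ext_T_conj x y : ext_T x -> ext_T (x ^ y).
Proof. by case=> z _ <-; exists (z * y) => //; rewrite conjgM. Qed.

Lemma ext_T_involution x : odd p -> x <> 1 -> x * x = 1 -> ext_T x.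
Proof.
case: x => [a e] p_odd x1 [aa _].
have aX : a ^+ ((p./2).*2).+1 = 1.
  have <- : p = ((p./2).*2).+1 by rewrite -[LHS]odd_double_half p_odd.
  exact: burnside_exp.
case: e x1 aa => /= x1 aa; last first.
  case: x1; congr (_, _).
  by move: aX; rewrite expgS -mul2n expgnA expg2 aa expg1n mulg1.
have tauX m (b : burnside n p) : tau (b ^+ m) = tau b ^+ m.
  elim: m => [|m IHm]; first exact: burnside_inverting1.
  by rewrite !expgS burnside_invertingM IHm.
have tau_a : tau a = a^-1 by apply: (mulgI a); rewrite aa mulgV.
pose b := a ^+ (p./2).+1.
have bb : b * b = a.
  by rewrite -expgnDr addSn addnS addnn expgS aX mulg1.
pose g : burnside_ext n p := (b, false).
exists g^-1 => //; rewrite conjgE invgK; congr (_, _).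
by rewrite /= mul1g burnside_invertingV tauX tau_a expVgn invgK bb.
Qed.

End BurnsideExt.

Arguments ext_t n p : clear implicits.
Arguments ext_T n p : clear implicits.

Section Linear.
Local Open Scope ring_scope.
Variables (F : fieldType) (V : lmodType F).

Definition subspace_set (U : set V) :=
  U 0 /\ forall (c : F) u v, U u -> U v -> U (c *: u + v).

Definition linear_span (S : set V) : set V := smallest subspace_set S.

Definition finite_dimensional :=
  exists2 S : set V, finite_set S & linear_span S = [set: V].

Definition gl_pred : pred (V -> V) := fun f => `[< linear f /\ bijective f >].

Definition gl : Type := {f : V -> V | gl_pred f}.
HB.instance Definition _ := Choice.on gl.

Lemma glP (f : gl) : linear (val f) /\ bijective (val f).
Proof. exact/asboolP/(valP f). Qed.

Fact gl1_subproof : gl_pred idfun.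
Proof. by apply/asboolP; split; [move=> c u v|exists idfun]. Qed.

Fact glM_subproof (f g : gl) : gl_pred (val f \o val g).
Proof.
have [[linf bijf] [ling bijg]] := (glP f, glP g).
by apply/asboolP; split; [move=> c u v /=; rewrite ling linf|apply: bij_comp].
Qed.

Fact glV_exists (f : gl) :
  exists g : gl, cancel (val f) (val g) /\ cancel (val g) (val f).
Proof.
have [linf [g fK gK]] := glP f.
have gP : gl_pred g.
  apply/asboolP; split; last by exists (val f).
  by move=> c u v; apply: (can_inj fK); rewrite gK linf !gK.
by exists (Sub g gP).
Qed.

Definition gl1 : gl := Sub idfun gl1_subproof.
Definition gl_mul (f g : gl) : gl := Sub (val f \o val g) (glM_subproof f g).
Definition gl_inv (f : gl) : gl := sval (cid (glV_exists f)).

Fact gl_mulA : associative gl_mul.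
Proof. by move=> f g h; apply: val_inj. Qed.
Fact gl_mul1 : left_id gl1 gl_mul.
Proof. by move=> f; apply: val_inj. Qed.
Fact gl_mulr1 : right_id gl1 gl_mul.
Proof. by move=> f; apply: val_inj. Qed.
Fact gl_mulV : left_inverse gl1 gl_inv gl_mul.
Proof.
by move=> f; apply/val_inj/funext => u /=; rewrite /gl_inv; case: cid => g [/= -> _].
Qed.
Fact gl_mulrV : right_inverse gl1 gl_inv gl_mul.
Proof.
by move=> f; apply/val_inj/funext => u /=; rewrite /gl_inv; case: cid => g [/= _ ->].
Qed.

HB.instance Definition _ := isGroup.Build gl
  gl_mulA gl_mul1 gl_mulr1 gl_mulV gl_mulrV.

End Linear.

Arguments finite_dimensional {F} V.

Section GeneratedGroup.
Local Open Scope group_scope.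
Variables (G : groupType) (S : set G).

Definition generated_pred : pred G := fun x => x \in generated S.

Definition generated_group : Type := {x : G | generated_pred x}.

HB.instance Definition _ := SubChoice.on generated_group.

Fact generated_closed : group_closed generated_pred.
Proof.
have [G1 GF] := generated_subgroup S.
split=> [|x y Gx Gy]; first exact: mem_set.
by apply: mem_set; apply: GF; apply: set_mem.
Qed.

HB.instance Definition _ :=
  SubChoice_isSubGroup.Build G generated_pred generated_group generated_closed.

End GeneratedGroup.

Definition isomorphic_groups (G H : groupType) :=
  exists f : {multiplicative G -> H}, bijective f.

(* Modules with a bilinear, not necessarily associative or commutative, product. *)
HB.mixin Record hasBilinearProduct (R : pzRingType) V of GRing.Lmodule R V := {
  amul : V -> V -> V;
  amulDl : left_distributive amul +%R;
  amulDr : right_distributive amul +%R;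
  amulZl : forall (c : R) u v, (amul (c *: u) v = c *: amul u v)%R;
  amulZr : forall (c : R) u v, (amul u (c *: v) = c *: amul u v)%R }.

#[short(type="nonassocAlgType")]
HB.structure Definition NonassocAlgebra (R : pzRingType) :=
  { V of hasBilinearProduct R V & GRing.Lmodule R V }.

(* The involutions of the dihedral group <a, b>. *)
Definition involutions (G : groupType) (a b : G) : set G :=
  [set x | generated [set a; b] x /\ x <> 1%g /\ (x * x = 1)%g].

(* The free F-module on [T]; [eta] is a parameter because it fixes the product. *)
Definition inv_algebra (F : fieldType) (G : groupType) (T : set G) (eta : F) : Type :=
  {malg F[T]}.

HB.instance Definition _ F G T eta := GRing.Lmodule.on (@inv_algebra F G T eta).

Section InvolutionAlgebra.
Local Open Scope ring_scope.
Variables (F : fieldType) (G : groupType) (T : set G) (eta : F).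
Local Notation A := (inv_algebra T eta).

(* The basis vector of [x] for [x] in [T]. The value 0 outside [T] is never used
   when [T] is closed under conjugation and contains every involution of [G], as
   [ext_T] does for odd p ([ext_T_conj], [ext_T_involution]). *)
Definition bvec (x : G) : A :=
  if insub x is Some y then << y >> else 0.

Definition basis_mul (a b : T) : A :=
  if a == b then bvec (val a)
  else bvec (val b ^ val a)%g
       + eta *: \sum_(x \in involutions (val a) (val b) `\ (val b ^ val a)%g) bvec x.

Definition inv_mul (u v : A) : A :=
  \sum_(a <- msupp u) \sum_(b <- msupp v) (u@_a * v@_b) *: basis_mul a b.

Fact inv_mulE (X Y : {fset T}) (u v : A) :
  {subset msupp u <= X} -> {subset msupp v <= Y} ->
  inv_mul u v = \sum_(a <- X) \sum_(b <- Y) (u@_a * v@_b) *: basis_mul a b.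
Proof.
move=> /fsubsetP uA /fsubsetP vB; rewrite /inv_mul.
rewrite (big_fset_incl _ uA) /=; last first.
  move=> a _ /mcoeff_outdom ua; rewrite big1 // => b _.
  by rewrite ua mul0r scale0r.
apply: eq_bigr => a _; rewrite (big_fset_incl _ vB) //.
by move=> b _ /mcoeff_outdom vb; rewrite vb mulr0 scale0r.
Qed.

Fact inv_mulDl : left_distributive inv_mul +%R.
Proof.
move=> u v w; pose X := (msupp u `|` msupp v)%fset.
have sub a : a \in msupp (u + v) -> a \in X by move/(fsubsetP (msuppD_le _ _)).
have subl a : a \in msupp u -> a \in X by move=> au; rewrite /X in_fsetU au.
have subr a : a \in msupp v -> a \in X by move=> av; rewrite /X in_fsetU av orbT.
rewrite !(@inv_mulE X (msupp w)) // -big_split /=.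
apply: eq_bigr => a _; rewrite -big_split; apply: eq_bigr => b _ /=.
by rewrite mcoeffD mulrDl scalerDl.
Qed.

Fact inv_mulDr : right_distributive inv_mul +%R.
Proof.
move=> w u v; pose X := (msupp u `|` msupp v)%fset.
have sub a : a \in msupp (u + v) -> a \in X by move/(fsubsetP (msuppD_le _ _)).
have subl a : a \in msupp u -> a \in X by move=> au; rewrite /X in_fsetU au.
have subr a : a \in msupp v -> a \in X by move=> av; rewrite /X in_fsetU av orbT.
rewrite !(@inv_mulE (msupp w) X) // -big_split /=.
apply: eq_bigr => a _; rewrite -big_split; apply: eq_bigr => b _ /=.
by rewrite mcoeffD mulrDr scalerDl.
Qed.

Fact inv_mulZl (c : F) u v : inv_mul (c *: u) v = c *: inv_mul u v.
Proof.
rewrite (@inv_mulE (msupp u) (msupp v)) //; last first.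
  by move=> a; rewrite -!mcoeff_neq0 mcoeffZ mulf_eq0 negb_or => /andP[].
rewrite /inv_mul scaler_sumr; apply: eq_bigr => a _; rewrite scaler_sumr.
by apply: eq_bigr => b _; rewrite mcoeffZ -mulrA scalerA.
Qed.

Fact inv_mulZr (c : F) u v : inv_mul u (c *: v) = c *: inv_mul u v.
Proof.
rewrite (@inv_mulE (msupp u) (msupp v)) //; last first.
  by move=> a; rewrite -!mcoeff_neq0 mcoeffZ mulf_eq0 negb_or => /andP[].
rewrite /inv_mul scaler_sumr; apply: eq_bigr => a _; rewrite scaler_sumr.
by apply: eq_bigr => b _; rewrite mcoeffZ mulrCA scalerA.
Qed.

HB.instance Definition _ := hasBilinearProduct.Build F A
  inv_mulDl inv_mulDr inv_mulZl inv_mulZr.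

Lemma amul_bvec (a b : T) : amul (bvec (val a)) (bvec (val b)) = basis_mul a b.
Proof.
rewrite /bvec !valK /amul /= /inv_mul !msuppU oner_eq0 !big_seq_fset1.
by rewrite !mcoeffUU mulr1 scale1r.
Qed.

End InvolutionAlgebra.

Section Miyamoto.
Local Open Scope ring_scope.
Variables (F : fieldType) (G : groupType) (T : set G) (eta : F) (p : nat).
Local Notation A := (inv_algebra T eta).
Local Notation e := (@bvec F G T eta).

(* Indexed from 0: [dihedral_seq a b i] is the (i+1)-st term of the enumeration
   a_1 = a, a_2 = b, a_(i+1) = a_(i-1) ^ a_i of [involutions a b]. *)
Fixpoint dihedral_seq (a b : G) (i : nat) : G :=
  match i with
  | 0 => a
  | 1 => b
  | (j.+1 as k).+1 => (dihedral_seq a b j ^ dihedral_seq a b k)%g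
  end.

(* The basis vector of a_i, with i counted from 1. *)
Definition dvec (a b : G) (i : nat) : A := e (dihedral_seq a b i.-1).

Definition vec_z (a b : G) : A :=
  (p - 2)%:R^-1 *: e a + \sum_(1 <= j < p.+1) dvec a b j.

Definition vec_y (a b : G) (i : nat) : A :=
  dvec a b i.+1 - dvec a b (p.+1)./2 - dvec a b (p.+3)./2 + dvec a b (p.+1 - i).

Definition vec_x (a b : G) (i : nat) : A := dvec a b (p.+1 - i) - dvec a b i.+1.

Definition A_plus (a : G) : set A :=
  linear_span [set v | v = e a \/ exists b, [/\ T b, b <> a &
    v = vec_z a b \/
    exists i : nat, (1 <= i <= (p - 3)./2)%N /\ v = vec_y a b i]].

Definition A_minus (a : G) : set A :=
  linear_span [set v | exists b, [/\ T b, b <> a &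
    exists i : nat, (1 <= i <= p.-1./2)%N /\ v = vec_x a b i]].

(* Determines [f] uniquely, the algebra being the direct sum of [A_plus a] and
   [A_minus a]. *)
Definition is_miyamoto_involution (a : G) (f : gl A) :=
  (forall v, A_plus a v -> val f v = v) /\ (forall v, A_minus a v -> val f v = - v).

Definition Miy : groupType :=
  generated_group [set f : gl A | exists2 a, T a & is_miyamoto_involution a f].

End Miyamoto.

Definition good_characteristic (F : fieldType) (p : nat) (eta : F) : bool :=
  uniq [:: 1; eta * (p - 2)%:R + 1; eta - 1; 1 - eta]%R.

(* Main.v *)
From HB Require Import structures.
Require Import Defs.
From mathcomp Require Import all_boot all_algebra.
From mathcomp Require Import boolp classical_sets functions cardinality.
From mathcomp Require Import finmap monalg.
From mathcomp Require Import zify.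

Import GRing.Theory.
Set Implicit Arguments.
Unset Strict Implicit.
Unset Printing Implicit Defensive.

Local Open Scope classical_set_scope.
Local Open Scope group_scope.

(** The Miyamoto involution of [a] is conjugation by [a], extended linearly
    from the basis [T] to the algebra. In the dihedral group of [a] and [b] the
    enumeration is a_(k+1) = a (ab)^k, and (ab)^p = 1, so conjugation by [a]
    reflects the indices, exchanging a_(i+1) and a_(p+1-i)
    ([dihedral_seq_conj]). Hence it fixes the vectors z and y_i and negates the
    x_i. Conversely these vectors and [a] span the algebra
    ([plus_minus_span]), so no other linear map has this property
    ([miyamoto_involutionE]). The span needs 2 and (p-1)/2 to be invertible; the
    second is what good characteristic gives, since p = 1 in the field would
    make eta (p-2) + 1 equal to 1 - eta.

    Therefore the Miyamoto group is the image of the group generated by [T]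
    acting by conjugation on the basis vectors, and the kernel of this action is
    the centralizer of [T]. For the extension of the Burnside group, [T]
    generates everything ([generated_ext_T]): a product of two conjugates of t
    can be any generator, because squaring is invertible in exponent p. So the
    centralizer of [T] is the center, and the first isomorphism theorem
    concludes ([miyamoto_group_iso]).

    For the finiteness statement, a finite spanning set involves only finitely
    many basis vectors, so a finite-dimensional algebra has a finite basis [T]
    ([finite_dimensional_inv_algebra]). A finite set of involutions closed under
    conjugation generates a finite group ([dietzmann_involutions], a case of
    Dietzmann's lemma), whence G is finite. *)

(** * Generation, quotients and finiteness of groups *)

Lemma group_morph1 (G H : groupType) (f : G -> H) :
  {morph f : x y / x * y} -> f 1 = 1.
Proof. by move=> fM; apply: (mulgI (f 1)); rewrite -fM !mulg1. Qed.

Lemma group_morphV (G H : groupType) (f : G -> H) :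
  {morph f : x y / x * y} -> {morph f : x / x^-1}.
Proof.
by move=> fM x; apply: (mulgI (f x)); rewrite -fM !mulgV; apply: group_morph1.
Qed.

Lemma first_isomorphism (G H : groupType) (M : normal_subgroup G) (f : G -> H) :
  {morph f : x y / x * y} -> (forall h, exists g, f g = h) ->
  (forall g, f g = 1 <-> nsubgroup_set M g) ->
  isomorphic_groups H (quotient_group M).
Proof.
move=> fM fS fK.
have fP x y : f x = f y <-> quotient_map M x = quotient_map M y.
  rewrite quotient_mapP -fK fM (group_morphV fM); split=> [->|xy1].
    exact: mulVg.
  by apply: (mulgI (f x)^-1); rewrite xy1 mulVg.
pose q h := quotient_map M (sval (cid (fS h))).
have qP x : q (f x) = quotient_map M x by apply/fP; rewrite /q; case: cid.
have qM : {morph q : x y / x * y}.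
  move=> h k; case: (fS h) (fS k) => [x <-] [y <-].
  by rewrite -fM !qP quotient_mapM.
pose qmul := monoid.isMultiplicative.Build H (quotient_group M) q qM.
pose qmor : {multiplicative H -> quotient_group M} := HB.pack q qmul.
exists qmor; exists (fun c => f (quotient_repr c)) => [h|c] /=.
  by case: (fS h) => x <-; rewrite qP; apply/fP; rewrite quotient_reprK.
by rewrite qP quotient_reprK.
Qed.

Lemma generated_ind (G : groupType) (S : set G) (P : G -> Prop) :
  P 1 -> (forall x y, P x -> P y -> P (x / y)) -> (forall x, S x -> P x) ->
  forall x, generated S x -> P x.
Proof. by move=> P1 PF PS x; apply; split. Qed.

Lemma generated_morph_image (G H : groupType) (f : G -> H) (S : set G) :
  {morph f : x y / x * y} -> generated (f @` S) = f @` generated S.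
Proof.
move=> fM; apply/seteqP; split.
  apply: smallest_sub.
    have [S1 SF] := generated_subgroup S; split.
      by exists 1 => //; apply: group_morph1.
    move=> _ _ [x Sx <-] [y Sy <-]; exists (x / y); first exact: SF.
    by rewrite fM (group_morphV fM).
  by apply: image_subset; apply: sub_gen_smallest.
move=> _ [x Sx <-]; apply: (Sx [set x | generated (f @` S) (f x)]); split.
  have [S1 SF] := generated_subgroup (f @` S); split=> /=.
    by rewrite (group_morph1 fM).
  by move=> y z Sy Sz /=; rewrite fM (group_morphV fM); apply: SF.
by move=> y Sy /=; apply: sub_gen_smallest; exists y.
Qed.

Lemma generated_centralizer (G : groupType) (T : set G) (g : G) :
  generated T = [set: G] ->
  (forall x, T x -> x ^ g^-1 = x) <-> center g.
Proof.
move=> genT; split=> [cT|cg x _]; last first.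
  by rewrite conjgE invgK mulgA cg mulgK.
move=> x; have: generated T x by rewrite genT.
apply: (generated_ind (P := fun x => g * x = x * g)) => {x} [|x y cx cy|x].
- by rewrite mulg1 mul1g.
- rewrite mulgA cx -!mulgA; congr (_ * _).
  by apply: (mulgI y); rewrite mulVKg mulgA -cy mulgK.
- by move=> /cT; rewrite conjgE invgK mulgA => {2}<-; rewrite mulgVK.
Qed.

(** A repeated letter can be cancelled: if [a] is an involution, then
    [a v a = v ^ a], which is a word in conjugates of the letters of [v]. *)
Lemma involution_prod_shorten (G : groupType) (s : seq G) :
  (forall x, x \in s -> x * x = 1) -> ~~ uniq s ->
  exists r, [/\ (size r < size s)%N, \prod_(x <- r) x = \prod_(x <- s) x &
    forall x, x \in r -> x \in s \/ exists y z, y \in s /\ x = y ^ z].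
Proof.
elim: s => [//|a s IHs] s2 /=; rewrite negb_and negbK.
case: (boolP (a \in s)) => [as_ _|_ /= nus].
- have [s1 [s2' def_s]] : exists s1 s2, s = s1 ++ a :: s2.
    by case/splitPr: as_ => s1 s2'; exists s1, s2'.
  have aa : a * a = 1 by apply: s2; rewrite mem_head.
  exists ([seq x ^ a | x <- s1] ++ s2'); split.
  + by rewrite def_s !size_cat size_map /= addnS ltnS leqW.
  + rewrite def_s big_cons !big_cat big_map /= big_cons -conjg_prod conjgE.
    have -> : a^-1 = a by apply: (mulgI a); rewrite mulgV aa.
    by rewrite !mulgA.
  + move=> x; rewrite mem_cat => /orP[/mapP[y ys1 ->]|xs]; [right|left].
      by exists y, a; rewrite def_s inE mem_cat ys1 orbT.
    by rewrite def_s inE mem_cat inE xs !orbT.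
have [|r [ltr prodr subr]] := IHs _ nus.
  by move=> x xs; apply: s2; rewrite inE xs orbT.
exists (a :: r); split=> //; first by rewrite !big_cons prodr.
move=> x; rewrite inE => /orP[/eqP->|/subr[xs|[y [z [ys ->]]]]].
- by left; rewrite mem_head.
- by left; rewrite inE xs orbT.
- by right; exists y, z; rewrite inE ys orbT.
Qed.

(** Every element is a word in [T], since involutions are their own inverses. A
    word of minimal length has no repeated letter by [involution_prod_shorten],
    so its length is at most the cardinality of [T], and there are finitely many
    such words. *)
Lemma dietzmann_involutions (G : groupType) (T : set G) :
  finite_set T -> (forall x y, T x -> T (x ^ y)) ->
  (forall x, T x -> x * x = 1) -> finite_set (generated T).
Proof.
move=> Tfin Tconj T2.
have TV x : T x -> x^-1 = x.
  by move=> /T2 xx; apply: (mulgI x); rewrite mulgV xx.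
pose X := fset_set T.
have XT x : (x \in X) = `[< T x >] by rewrite in_fset_set // inE.
have words x : generated T x ->
    exists2 s : seq G, (forall y, y \in s -> T y) & \prod_(y <- s) y = x.
  apply: (generated_ind (P := fun x => exists2 s : seq G,
      (forall y, y \in s -> T y) & \prod_(y <- s) y = x)) x
    => [|_ _ [s sT <-] [r rT <-]|x Tx].
  - by exists [::]; rewrite ?big_nil.
  - exists (s ++ rev r).
      by move=> y; rewrite mem_cat mem_rev => /orP[/sT|/rT].
    rewrite big_cat /=; congr (_ * _).
    elim: r rT => [|y r IHr] rT; first by rewrite !big_nil invg1.
    rewrite rev_cons -cats1 big_cat big_seq1 big_cons invgM IHr.
      by rewrite (TV y) //; apply: rT; rewrite mem_head.
    by move=> z zr; apply: rT; rewrite inE zr orbT.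
  - by exists [:: x]; [move=> y; rewrite inE => /eqP-> | rewrite big_seq1].
have uwords m (s : seq G) : (size s <= m)%N -> (forall y, y \in s -> T y) ->
    exists r : seq G, [/\ uniq r, forall y, y \in r -> T y &
      \prod_(y <- r) y = \prod_(y <- s) y].
  elim: m s => [|m IHm] s sm sT.
    by exists s; split=> //; move: sm; rewrite leqn0 => /nilP->.
  have [us|/involution_prod_shorten[]] := boolP (uniq s); first by exists s.
    by move=> y /sT/T2.
  move=> r [rs <- rT]; apply: IHm; first by rewrite -ltnS (leq_trans rs).
  by move=> y /rT[/sT//|[z [w [/sT Tz ->]]]]; apply: Tconj.
pose words_of_size k := [set \prod_(i < k) val (w i) | w in [set: {ffun 'I_k -> X}]].
apply: (@sub_finite_set _ _ (\bigcup_(k in `I_(#|{: X}|.+1)) words_of_size k)).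
  move=> x /words[s sT <-]; have [r [ur rT <-]] := uwords _ s (leqnn _) sT.
  have rX y : y \in r -> y \in X by rewrite XT => /rT ?; apply/asboolP.
  exists (size r) => /=.
    rewrite ltnS -cardfE; apply: (@leq_trans #|` [fset y in r]%fset|).
      by rewrite card_fseq undup_id.
    by apply: fsubset_leq_card; apply/fsubsetP => y; rewrite inE => /rX.
  exists [ffun i : 'I_(size r) => [` rX _ (mem_nth 1 (ltn_ord i))]%fset] => //.
  rewrite (big_nth 1) big_mkord; apply: eq_bigr => i _.
  by rewrite ffunE.
apply: bigcup_finite; first exact: finite_II.
by move=> k _; apply: finite_image; apply: finite_finset.
Qed.

(** * Subspaces *)

Section Subspaces.
Local Open Scope ring_scope.
Variables (F : fieldType) (V : lmodType F).
Implicit Types U : set V.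

Lemma subspace_sum U (I : Type) (r : seq I) (P : pred I) (v : I -> V) :
  subspace_set U -> (forall i, P i -> U (v i)) -> U (\sum_(i <- r | P i) v i).
Proof.
move=> [U0 UD] Uv; apply: big_ind => // x y Ux Uy.
by rewrite -[x]scale1r; apply: UD.
Qed.

Lemma subspaceZ U c v : subspace_set U -> U v -> U (c *: v).
Proof. by move=> [U0 UD] Uv; rewrite -[_ *: _]addr0; apply: UD. Qed.

Lemma subspaceD U u v : subspace_set U -> U u -> U v -> U (u + v).
Proof. by move=> [U0 UD] Uu Uv; rewrite -[u]scale1r; apply: UD. Qed.

Lemma subspaceB U u v : subspace_set U -> U u -> U v -> U (u - v).
Proof.
by move=> US Uu Uv; apply: subspaceD => //; rewrite -scaleN1r; apply: subspaceZ.
Qed.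

Lemma linear_eq_subspace (f g : V -> V) :
  linear f -> linear g -> subspace_set [set v | f v = g v].
Proof.
move=> fL gL; split=> [|c u v /= fu fv] /=; last by rewrite fL gL fu fv.
have L0 h : linear h -> h 0 = 0 :> V.
  by move=> hL; have := hL (-1) 0 0; rewrite scaler0 addr0 scaleN1r addNr.
by rewrite !L0.
Qed.

End Subspaces.

(** * The basis of the algebra and its dimension *)

Section ConjugationRepresentation.
Local Open Scope ring_scope.
Variables (F : fieldType) (G : groupType) (T : set G) (eta : F).
Local Notation A := (inv_algebra T eta).
Local Notation e := (@bvec F G T eta).

Lemma bvec_val (x : T) : e (val x) = << x >>.
Proof. by rewrite /bvec valK. Qed.

Lemma bvec_coef (x : G) (y : T) : T x -> (e x)@_y = (x == val y)%:R.
Proof.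
move=> Tx; have xT : x \in T by apply: mem_set.
by rewrite /bvec insubT mcoeffU -val_eqE /=.
Qed.

Lemma bvec_inj x y : T x -> T y -> e x = e y -> x = y.
Proof.
move=> Tx Ty; have yT : y \in T by apply: mem_set.
move=> /(congr1 (mcoeff (Sub y yT : T))); rewrite !bvec_coef // /= eqxx.
by case: eqP => // _ /esym/eqP; rewrite oner_eq0.
Qed.

Lemma subspace_bvec (U : set A) :
  subspace_set U -> (forall x, T x -> U (e x)) -> forall v, U v.
Proof.
move=> US Ue v; rewrite [v]monalgE; apply: subspace_sum => // k _.
have -> : << v@_k *g k >> = v@_k *: e (val k) :> A.
  rewrite bvec_val; apply/malgP => l.
  by rewrite mcoeffZ !mcoeffU; case: eqP; rewrite ?mulr1 ?mulr0.
by apply: subspaceZ => //; apply: Ue; apply/set_mem/(valP k).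
Qed.

Lemma linear_bvec_ext (f g : A -> A) :
  linear f -> linear g -> (forall x, T x -> f (e x) = g (e x)) -> f =1 g.
Proof. by move=> fL gL; apply: (subspace_bvec (linear_eq_subspace fL gL)). Qed.

(** If a finite set spans, the union of the supports of its elements is finite,
    and it is all of [T]: otherwise the coefficient at some [x] vanishes on the
    spanning set, hence on the basis vector of [x]. *)
Lemma finite_dimensional_inv_algebra : finite_dimensional A <-> finite_set T.
Proof.
split=> [[S Sfin Sspan]|Tfin]; last first.
  exists (e @` T); first exact: finite_image.
  apply/seteqP; split=> // v _; apply: subspace_bvec.
    by split=> [U [[]]//|c x y Sx Sy U US]; apply: US.1.2; [apply: Sx|apply: Sy].
  by move=> x Tx; apply: sub_gen_smallest; exists x.
pose X : set T := \bigcup_(v in S) [set` msupp v].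
have Xfin : finite_set X by apply: bigcup_finite => // v _; apply: finite_fset.
apply: (@sub_finite_set _ _ ((fun x : T => val x) @` X)); last exact: finite_image.
move=> x Tx; have xT : x \in T by apply: mem_set.
exists (Sub x xT) => //; apply: contrapT => xX.
pose U : set A := [set v : A | v@_(Sub x xT : T) = 0].
have [US SU] : subspace_set U /\ S `<=` U.
  split; first split=> [|c u v]; rewrite /U /=; first exact: mcoeff0.
    by move=> u0 v0; rewrite mcoeffD mcoeffZ u0 v0 mulr0 addr0.
  move=> v Sv; apply/eqP; rewrite mcoeff_eq0; apply/negP => xv.
  by apply: xX; exists v.
have /(smallest_sub US SU) : linear_span S (e x) by rewrite Sspan.
by rewrite /U /= bvec_coef //= eqxx => /eqP; rewrite oner_eq0.
Qed.

(** * The conjugation representation *)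

(** The inverse makes this a left action, as composition in the linear group
    requires ([conj_linM]). *)
Definition conj_lin (g : G) (v : A) : A :=
  \sum_(k <- msupp v) v@_k *: e (val k ^ g^-1)%g.

Lemma conj_linE (X : {fset T}) g v : {subset msupp v <= X} ->
  conj_lin g v = \sum_(k <- X) v@_k *: e (val k ^ g^-1)%g.
Proof.
move=> /fsubsetP vX; apply: big_fset_incl => // k _ /mcoeff_outdom->.
by rewrite scale0r.
Qed.

Lemma conj_lin_linear g : linear (conj_lin g).
Proof.
move=> c u v; pose X := (msupp u `|` msupp v)%fset.
have uX : {subset msupp u <= X} by apply/fsubsetP/fsubsetUl.
have vX : {subset msupp v <= X} by apply/fsubsetP/fsubsetUr.
have uvX : {subset msupp (c *: u + v) <= X}.
  apply/fsubsetP/(fsubset_trans (msuppD_le _ _))/fsetUSS => //.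
  exact: msuppZ_le.
rewrite !(conj_linE (X := X)) // scaler_sumr -big_split /=.
by apply: eq_bigr => k _; rewrite mcoeffD mcoeffZ scalerDl scalerA.
Qed.

Hypothesis Tconj : forall x y, T x -> T (x ^ y)%g.

Lemma conj_lin_bvec g x : T x -> conj_lin g (e x) = e (x ^ g^-1)%g.
Proof.
move=> Tx; have xT : x \in T by apply: mem_set.
rewrite /conj_lin /bvec insubT msuppU oner_eq0 big_seq_fset1 mcoeffUU scale1r.
by rewrite SubK.
Qed.

Lemma conj_linM g h v : conj_lin (g * h)%g v = conj_lin g (conj_lin h v).
Proof.
move: v; apply: linear_bvec_ext; first exact: conj_lin_linear.
  by move=> c u v; rewrite !conj_lin_linear.
move=> x Tx; rewrite !conj_lin_bvec //; last exact: Tconj.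
by rewrite invgM conjgM.
Qed.

Lemma conj_lin1 v : conj_lin 1%g v = v.
Proof.
move: v; apply: linear_bvec_ext; first exact: conj_lin_linear.
  by [].
by move=> x Tx; rewrite conj_lin_bvec // invg1 conjg1.
Qed.

Fact conj_gl_subproof g : gl_pred (conj_lin g).
Proof.
apply/asboolP; split; first exact: conj_lin_linear.
by exists (conj_lin g^-1%g) => v; rewrite -conj_linM ?mulgV ?mulVg conj_lin1.
Qed.

Definition conj_gl g : gl A := Sub (conj_lin g) (conj_gl_subproof g).

Lemma conj_glM : {morph conj_gl : g h / (g * h)%g}.
Proof. by move=> g h; apply/val_inj/funext => v; apply: conj_linM. Qed.

Lemma conj_gl_ker g : conj_gl g = 1%g <-> forall x, T x -> (x ^ g^-1)%g = x.
Proof.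
split=> [g1 x Tx|cT].
  apply: bvec_inj => //; first exact: Tconj.
  by rewrite -conj_lin_bvec // -[conj_lin g]/(val (conj_gl g)) g1.
apply/val_inj/funext; apply: linear_bvec_ext; first exact: conj_lin_linear.
  by [].
by move=> x Tx; rewrite /= conj_lin_bvec // cT.
Qed.

(** * Miyamoto involutions are conjugations *)

Variable p : nat.
Hypothesis T2 : forall x, T x -> (x * x = 1)%g.
Hypothesis Tp : forall x y, T x -> T y -> ((x * y) ^+ p = 1)%g.

Lemma T_inv x : T x -> (x^-1)%g = x.
Proof. by move=> /T2 xx; apply: (mulgI x); rewrite mulgV xx. Qed.

Lemma T_dihedral_seq a b k : T a -> T b -> T (dihedral_seq a b k).
Proof.
move=> Ta Tb; suff [] : T (dihedral_seq a b k) /\ T (dihedral_seq a b k.+1) by [].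
by elim: k => [//|k [Tk Tk1]]; split=> //=; apply: Tconj.
Qed.

(** With [r = a * b], each term is an involution, so the recursion reads
    [d_(k+2) = d_(k+1) * d_k^-1 * d_(k+1) = a r^(k+1) r^-k r^(k+1)]. *)
Lemma dihedral_seqE a b k : T a -> T b ->
  dihedral_seq a b k = (a * (a * b) ^+ k)%g.
Proof.
move=> Ta Tb; suff [] : dihedral_seq a b k = (a * (a * b) ^+ k)%g /\
  dihedral_seq a b k.+1 = (a * (a * b) ^+ k.+1)%g by [].
elim: k => [|k [IHk IHk1]].
  by rewrite expg0 expg1 mulg1 mulgA T2 // mul1g.
split=> //.
have -> : dihedral_seq a b k.+2 = (dihedral_seq a b k ^ dihedral_seq a b k.+1)%g.
  by [].
have Tk1 : T (dihedral_seq a b k.+1) by apply: T_dihedral_seq.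
have Tk : T (dihedral_seq a b k) by apply: T_dihedral_seq.
rewrite conjgE (T_inv Tk1) -[dihedral_seq a b k](T_inv Tk) IHk IHk1.
by rewrite invgM -mulgA -(mulgA _ a^-1%g) mulKg expgS -(mulgA (a * b)%g) mulVKg !expgS.
Qed.

(** [a] inverts [a * b], whose order divides [p], so it reflects the indices. *)
Lemma dihedral_seq_conj a b k : T a -> T b -> (k <= p)%N ->
  (dihedral_seq a b k ^ a)%g = dihedral_seq a b (p - k).
Proof.
move=> Ta Tb kp; have Tk : T (dihedral_seq a b k) by apply: T_dihedral_seq.
rewrite -[dihedral_seq a b k](T_inv Tk) !dihedral_seqE // conjgE (T_inv Ta).
rewrite invgM (T_inv Ta) -!mulgA T2 // mulg1; congr (_ * _)%g.
by apply: (mulgI ((a * b) ^+ k)%g); rewrite mulgV -expgnDr subnKC // Tp.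
Qed.

Lemma conj_lin_dvec a b i : T a -> T b -> (i <= p)%N ->
  conj_lin a (dvec T eta a b i.+1) = dvec T eta a b (p.+1 - i).
Proof.
move=> Ta Tb ip; rewrite /dvec conj_lin_bvec; last exact: T_dihedral_seq.
by rewrite T_inv //= dihedral_seq_conj // subSn.
Qed.

Hypothesis p_odd : odd p.
Hypothesis two_neq0 : 2%:R != 0 :> F.
Hypothesis half_neq0 : (p./2)%:R != 0 :> F.

Local Notation m := (p./2).

Lemma p_half : p = m.*2.+1.
Proof. by rewrite -[LHS]odd_double_half p_odd. Qed.

Lemma half_gt0 : (0 < m)%N.
Proof. by case: m half_neq0 => //; rewrite eqxx. Qed.

Lemma half_p1 : (p.+1)./2 = m.+1.
Proof. by rewrite p_half /= doubleK uphalf_double. Qed.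

(** The indices (p+1)/2 and (p+3)/2 form the last reflected pair, the one with
    [i = m]; thus y_i is a difference of two reflected pairs. *)
Lemma vec_yE a b i : vec_y T eta p a b i =
  (dvec T eta a b i.+1 + dvec T eta a b (p.+1 - i))
  - (dvec T eta a b m.+1 + dvec T eta a b (p.+1 - m)).
Proof.
have -> : (p.+1 - m = m.+2)%N by rewrite p_half /= uphalf_double; lia.
rewrite /vec_y half_p1.
have -> : (p.+3)./2 = m.+2 by rewrite -half_p1.
by rewrite opprD -!addrA; congr (_ + _); rewrite [RHS]addrC -!addrA.
Qed.

(** The reflection fixes the index 1; as [i] runs upwards from 1 to [m], the
    index [i + 1] covers the lower half of the others upwards and [p + 1 - i]
    the upper half downwards. *)
Lemma sum_reflected_pairs (V : nmodType) (f : nat -> V) :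
  \sum_(1 <= j < p.+1) f j
  = f 1%N + \sum_(1 <= i < m.+1) (f i.+1 + f (p.+1 - i)%N).
Proof.
have mp : (m < p)%N by have := p_half; lia.
have m_gt0 := half_gt0.
rewrite big_ltn; last by lia.
congr (_ + _).
rewrite (@big_cat_nat _ _ _ m.+2 2 p.+1) ?ltnS // big_split /=; congr (_ + _).
  by rewrite big_add1.
rewrite big_nat_rev /= -[m.+2]/(1 + m.+1)%N big_addn.
have -> : (p.+1 - m.+1 = m.+1)%N by rewrite {1}p_half; lia.
by apply: eq_bigr => i _; congr (f _); lia.
Qed.

Lemma vec_z_pairs a b : vec_z T eta p a b =
  ((p - 2)%:R^-1 + 1) *: e a
  + \sum_(1 <= i < m.+1) (dvec T eta a b i.+1 + dvec T eta a b (p.+1 - i)).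
Proof.
by rewrite /vec_z (sum_reflected_pairs (dvec T eta a b)) scalerDl scale1r addrA.
Qed.

Lemma conj_lin_pair a b i : T a -> T b -> (1 <= i <= p)%N ->
  conj_lin a (dvec T eta a b i.+1 + dvec T eta a b (p.+1 - i))
  = dvec T eta a b i.+1 + dvec T eta a b (p.+1 - i).
Proof.
move=> Ta Tb /andP[i_gt0 ip]; have aL := conj_lin_linear a.
rewrite -[dvec T eta a b i.+1 in LHS]scale1r aL scale1r.
have -> : (p.+1 - i = (p - i).+1)%N by lia.
rewrite !conj_lin_dvec //; try lia.
by rewrite addrC; congr (dvec _ _ _ _ _ + dvec _ _ _ _ _); lia.
Qed.

Lemma conj_gl_plus a : T a -> A_plus p a `<=` [set v | val (conj_gl a) v = v].
Proof.
move=> Ta; have aL := conj_lin_linear a.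
have US : subspace_set [set v | conj_lin a v = v].
  by apply: (linear_eq_subspace aL (g := idfun)).
have m_gt0 := half_gt0; have pE := p_half.
apply: (smallest_sub US) => v /= [->|[b [Tb _ bv]]].
  by rewrite conj_lin_bvec // (T_inv Ta) conjgE (T_inv Ta) mulgA T2 // mul1g.
have pairP i : (1 <= i <= p)%N -> _ := fun iP => conj_lin_pair Ta Tb iP.
case: bv => [->|[i [ip ->]]].
  rewrite vec_z_pairs; apply: (subspaceD US).
    apply: (subspaceZ _ US) => /=.
    by rewrite conj_lin_bvec // (T_inv Ta) conjgE (T_inv Ta) mulgA T2 // mul1g.
  rewrite big_nat; apply: (subspace_sum _ US) => i im; apply: pairP; lia.
by rewrite vec_yE; apply: (subspaceB US); apply: pairP; lia.
Qed.

Lemma conj_gl_minus a : T a ->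
  A_minus p a `<=` [set v | val (conj_gl a) v = - v].
Proof.
move=> Ta; have aL := conj_lin_linear a.
have US : subspace_set [set v : A | conj_lin a v = - v].
  by apply: (linear_eq_subspace aL (g := -%R)) => c x y; rewrite opprD scalerN.
have pE := p_half.
apply: (smallest_sub US) => _ /= [b [Tb _ [i [ip ->]]]] /=.
rewrite /vec_x addrC -scaleN1r aL.
have -> : (p.+1 - i = (p - i).+1)%N by lia.
rewrite !conj_lin_dvec //; try lia.
by rewrite !scaleN1r opprD opprK addrC; congr (dvec _ _ _ _ _ - dvec _ _ _ _ _); lia.
Qed.

(** Let s_i be the sum of the i-th reflected pair, for i from 1 to m. Modulo [a]
    the vector z is the sum of all s_i, and y_i = s_i - s_m, so the span of [a],
    z and the y_i contains m s_m, hence s_m, hence s_1. Finally s_1 - x_1 = 2 b. *)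
Lemma plus_minus_span (a : G) (U : set A) : T a -> subspace_set U ->
  A_plus p a `<=` U -> A_minus p a `<=` U -> forall v, U v.
Proof.
move=> Ta US PU MU; apply: subspace_bvec => // b Tb.
have m_gt0 := half_gt0; have pE := p_half.
have Ua : U (e a) by apply: PU; apply: sub_gen_smallest; left.
have [->//|/eqP ba] := eqVneq b a.
pose s i : A := dvec T eta a b i.+1 + dvec T eta a b (p.+1 - i).
have Uy i : (1 <= i <= m)%N -> U (s i - s m).
  move=> im; have [->|nim] := eqVneq i m; first by rewrite subrr; case: US.
  rewrite -vec_yE; apply: PU; apply: sub_gen_smallest; right.
  by exists b; split=> //; right; exists i; split=> //; lia.
have Us : U (\sum_(1 <= i < m.+1) s i).
  rewrite -[X in U X](addKr (((p - 2)%:R^-1 + 1) *: e a)) -vec_z_pairs addrC.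
  apply: subspaceB => //; last exact: subspaceZ.
  by apply: PU; apply: sub_gen_smallest; right; exists b; split=> //; left.
have Usm : U (s m).
  rewrite -[s m](scalerK half_neq0); apply: subspaceZ => //.
  have -> : m%:R *: s m = \sum_(1 <= i < m.+1) s i - \sum_(1 <= i < m.+1) (s i - s m).
    by rewrite sumrB subKr sumr_const_nat subn1 scaler_nat.
  apply: subspaceB => //; rewrite big_nat; exact: subspace_sum.
have Us1 : U (s 1%N).
  by rewrite -[s 1%N](subrK (s m)); apply: subspaceD => //; apply: Uy; lia.
have Ux1 : U (vec_x T eta p a b 1).
  apply: MU; apply: sub_gen_smallest; exists b; split=> //; exists 1%N.
  by split=> //; lia.
have -> : e b = 2%:R^-1 *: (s 1%N - vec_x T eta p a b 1).
  rewrite /s /vec_x opprB addrACA subrr addr0.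
  by rewrite -mulr2n -scaler_nat scalerK.
by apply: subspaceZ => //; apply: subspaceB.
Qed.

Lemma miyamoto_involutionE a (f : gl A) : T a ->
  is_miyamoto_involution p a f <-> f = conj_gl a.
Proof.
move=> Ta; split=> [[fp fm]|->]; last first.
  by split=> v; [apply: conj_gl_plus|apply: conj_gl_minus].
apply/val_inj/funext; apply: (plus_minus_span Ta) => [|v vp|v vm] /=.
- exact: linear_eq_subspace (glP f).1 (conj_lin_linear a).
- by rewrite fp //; apply/esym; apply: (conj_gl_plus Ta vp).
- by rewrite fm //; apply/esym; apply: (conj_gl_minus Ta vm).
Qed.

Lemma miyamoto_group_iso : generated T = [set: G] ->
  isomorphic_groups (Miy T eta p) (quotient_group (center_subgroup G)).
Proof.
move=> genT; rewrite /Miy.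
set S := (S in generated_group S).
have genS : generated S = [set conj_gl g | g in [set: G]].
  rewrite -genT -(generated_morph_image _ conj_glM); congr generated.
  apply/seteqP; split=> [f [a Ta /(miyamoto_involutionE _ Ta)->]|_ [a Ta <-]].
    by exists a.
  by exists a => //; apply/miyamoto_involutionE.
have inM g : generated_pred S (conj_gl g).
  by apply: mem_set; rewrite genS; exists g.
pose phi g : Miy T eta p := Sub (conj_gl g) (inM g).
apply: (@first_isomorphism _ _ _ phi) => [g h|h|g].
- by apply: val_inj; rewrite valM /= conj_glM.
- have: generated S (val h) by apply: set_mem; apply: (valP h).
  by rewrite genS => -[g _ gh]; exists g; apply: val_inj.
- rewrite /= -(generated_centralizer g genT) -conj_gl_ker; split=> [/(congr1 val)|g1].
    by rewrite (val1 (generated_group S)).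
  by apply: val_inj; rewrite val1.
Qed.

End ConjugationRepresentation.

(** If (p-1)/2 vanishes in [F], then p - 2 = -1 there, and two of the values
    that good characteristic separates, eta (p-2) + 1 and 1 - eta, agree. *)
Lemma good_characteristic_half (F : fieldType) (p : nat) (eta : F) :
  odd p -> (2 < p)%N -> good_characteristic p eta -> ((p./2)%:R != 0 :> F)%R.
Proof.
move=> p_odd p_gt2; rewrite /good_characteristic /= !inE => good.
apply: contraTneq good => half0.
have -> : ((p - 2)%:R = -1 :> F)%R.
  have -> : (p - 2 = (p./2 + p./2) - 1)%N by have := odd_double_half p; lia.
  by rewrite natrB ?natrD ?half0 ?addr0 ?sub0r //; lia.
by rewrite mulrN1 [(- eta + 1)%R]addrC eqxx !orbT /= ?andbF.
Qed.

(** * The extension of the Burnside group by the inverting automorphism *)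

Section BurnsideExtension.
Variables n p : nat.
Local Notation B := (burnside n p).
Local Notation E := (burnside_ext n p).
Local Notation t := (ext_t n p).
Local Notation T := (ext_T n p).

Lemma ext_inl_exp (b : B) k : ((b, false) : E) ^+ k = (b ^+ k, false).
Proof. by elim: k => [//|k IHk]; rewrite !expgS IHk. Qed.

Lemma ext_T_square x : T x -> x * x = 1.
Proof.
have tt : t * t = 1 by congr (_, _); rewrite /= burnside_inverting1 mulg1.
by case=> y _ <-; rewrite -conjMg tt conj1g.
Qed.

Lemma ext_T_snd x : T x -> x.2 = true.
Proof. by case=> -[b e] _ <-; rewrite conjgE /=; case: e. Qed.

Lemma ext_T_mul_exp x y : T x -> T y -> (x * y) ^+ p = 1.
Proof.
move=> /ext_T_snd; case: x => a e /= ->; move=> /ext_T_snd; case: y => b f /= ->.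
by rewrite ext_inl_exp burnside_exp.
Qed.

(** For [h] in the Burnside group inverted by t, [t ^ h * t = h ^- 2]; the power
    [h = g ^+ ((p - 1) / 2)] makes this [g ^+ (1 - p) = g]. *)
Lemma burnside_gen_ext (i : 'I_n) : odd p ->
  exists x y : E, [/\ T x, T y & x * y = (burnside_gen p i, false)].
Proof.
move=> p_odd; pose g := burnside_gen p i; pose h : E := (g ^+ p./2, false).
exists (t ^ h), t; split; [by exists h | by exists 1; rewrite ?conjg1|].
have invX k : burnside_inverting (g ^+ k) = (g ^+ k)^-1.
  elim: k => [|k IHk]; first by rewrite burnside_inverting1 invg1.
  by rewrite expgS burnside_invertingM IHk burnside_inverting_gen -invgM -expgSr expgS.
congr (_, _); rewrite /= burnside_inverting1 mulg1 mul1g invX -invgM -expgnDr addnn.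
apply: (mulgI (g ^+ (p./2).*2)); rewrite mulgV -expgSr.
have -> : (p./2).*2.+1 = p by rewrite -[RHS]odd_double_half p_odd.
by rewrite burnside_exp.
Qed.

Lemma generated_ext_T : odd p -> generated T = [set: E].
Proof.
move=> p_odd; apply/seteqP; split=> // -[a e] _.
have [gen1 genF] := generated_subgroup T.
have genV x : generated T x -> generated T x^-1.
  by move=> Tx; rewrite -[x^-1]mul1g; apply: genF.
have genM x y : generated T x -> generated T y -> generated T (x * y).
  by move=> Tx Ty; rewrite -[y]invgK; apply: genF => //; apply: genV.
have sub x : T x -> generated T x by apply: sub_gen_smallest.
have gen_gen i : generated T ((burnside_gen p i, false) : E).
  by have [x [y [Tx Ty <-]]] := burnside_gen_ext i p_odd; apply: genM; apply: sub.
have genB : generated T ((a, false) : E).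
  elim/burnside_ind: a => [//|i a genA|i a genA].
    exact: (genM (burnside_gen p i, false) (a, false)).
  apply: (genM ((burnside_gen p i)^-1, false) (a, false)) => //.
  exact: (genV (burnside_gen p i, false)).
case: e => //.
have -> : ((a, true) : E) = ((a, false) : E) * t by congr (_, _); rewrite /= mulg1.
by apply: genM => //; apply: sub; exists 1; rewrite ?conjg1.
Qed.

End BurnsideExtension.

Theorem corollary1 (n p : nat) (n_gt0 : (0 < n)%N)
    (p_prime : prime p) (p_gt2 : (2 < p)%N)
    (F : fieldType) (char_neq2 : 2%N \notin [pchar F]%R)
    (eta : F) (eta_neq0 : eta != 0%R) (eta_neq1 : eta != 1%R)
    (good : good_characteristic p eta) :
  isomorphic_groups (Miy (ext_T n p) eta p)
                    (quotient_group (center_subgroup (burnside_ext n p))) /\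
  (finite_set [set: burnside_ext n p]%classic <->
   finite_dimensional (inv_algebra (ext_T n p) eta)).
Proof.
have p_odd : odd p by case/even_prime: p_prime p_gt2 => [->|].
have Tconj := @ext_T_conj n p; have T2 := @ext_T_square n p.
have two_neq0 : (2%:R != 0 :> F)%R by move: char_neq2; rewrite inE.
have half_neq0 := good_characteristic_half p_odd p_gt2 good.
have genT := @generated_ext_T n p p_odd.
split; first by apply: miyamoto_group_iso => //; apply: ext_T_mul_exp.
rewrite finite_dimensional_inv_algebra -genT; split=> [|Tfin].
  by apply: sub_finite_set; apply: sub_gen_smallest.
exact: dietzmann_involutions.
Qed.
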